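(* Let $p\geq 3$ be an integer and let $P\subset\mathbb{R}^2$ be a regular $p$-gon (the closed polygonal curve). Then there is no sequence $(E_n)_{n\ge 1}$ of polyellipses in the plane such that $E_n\to P$ with respect to the Hausdorff distance. (The number of focuses of $E_n$ is finite for each $n$, but may depend on $n$ and be arbitrarily large.)
   Context: $d$ denotes the Euclidean distance in the plane. Given finitely many not necessarily different points $F_1,\ldots,F_m$ ($m\ge 1$) in the plane and a real number $c$, the set $\{X\in\mathbb{R}^2 : \sum_{i=1}^m d(X,F_i)=c\}$ (assumed nonempty) is called a polyellipse with focuses $F_1,\ldots,F_m$. The Hausdorff distance of nonempty compact sets $K,L\subset\mathbb{R}^2$ is $h(K,L)=\max\{\max_{X\in K}\min_{Y\in L}d(X,Y),\ \max_{Y\in L}\min_{X\in K}d(X,Y)\}$. *)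

(* Defs.v *)
From mathcomp Require Import all_boot all_order all_algebra.
From mathcomp Require Import all_classical all_reals all_analysis.

Set Implicit Arguments.
Unset Strict Implicit.
Unset Printing Implicit Defensive.

Import Order.TTheory GRing.Theory Num.Theory.
Import numFieldNormedType.Exports.

Local Open Scope classical_set_scope.
Local Open Scope ring_scope.

(* The norm of the library on R * R is the sup norm, so the Euclidean distance
   is spelled out. *)
Definition edist (R : realType) (X Y : R * R) : R :=
  Num.sqrt ((X.1 - Y.1) ^+ 2 + (X.2 - Y.2) ^+ 2).

(* F : 'I_m -> R * R need not be injective: focuses may be repeated. *)
Definition polyellipse (R : realType) (E : set (R * R)) : Prop :=
  exists m : nat, exists F : 'I_m -> R * R, exists c : R,
    [/\ (1 <= m)%N,
        E = [set X | \sum_(i < m) edist X (F i) = c] &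
        E !=set0].

(* sup and inf take the default value 0 on unbounded sets; this is the Hausdorff
   distance for nonempty compact K and L, where they are a max and a min. *)
Definition hausdorff_dist (R : realType) (K L : set (R * R)) : R :=
  Num.max (sup [set inf [set edist X Y | Y in L] | X in K])
          (sup [set inf [set edist X Y | X in K] | Y in L]).

Definition segment (R : realType) (A B : R * R) : set (R * R) :=
  [set ((1 - t) * A.1 + t * B.1, (1 - t) * A.2 + t * B.2) | t in `[0, 1]].

Definition regular_vertex (R : realType) (p : nat) (O : R * R) (r a : R)
    (k : nat) : R * R :=
  (O.1 + r * cos (a + k%:R * (2 * pi) / p%:R),
   O.2 + r * sin (a + k%:R * (2 * pi) / p%:R)).

(* The last edge joins the vertex of index p - 1 to that of index p, which is
   the vertex of index 0. *)
Definition regular_polygon (R : realType) (p : nat) (P : set (R * R)) : Prop :=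
  exists O : R * R, exists r : R, exists a : R,
    0 < r /\
    P = \bigcup_(k in `I_p)
          segment (regular_vertex p O r a k) (regular_vertex p O r a k.+1).

(* Main.v *)
(* On a line missing the focus F, the distance to F is strictly convex; hence if
   a sum of distances were constant on three consecutive edges, every focus would
   lie on three lines with no common point. To make this survive a limit in
   which focuses may escape to infinity, both sides are weighted by 1 / (|F| + r):
   the convexity defect of the distance to F, summed over three edges, is at
   least k / (|F| + r), while near the polygon this distance is affine up to an
   error with Lipschitz constant at most K / (|F| + r). If the level set passes
   e-close to the vertices and the midpoints of the edges, then the values of the
   sum at three vertices control the affine part, the convexity defects control
   the rest, and the Lipschitz constant N of the sum satisfies N <= e C N; this is
   absurd for e < 1 / C. *)
Require Import Defs.
From mathcomp Require Import all_boot all_order all_algebra.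
From mathcomp Require Import all_classical all_reals all_analysis.
From mathcomp Require Import ring lra.
Import Order.TTheory GRing.Theory Num.Theory.
Import numFieldNormedType.Exports.
Local Open Scope classical_set_scope.
Local Open Scope ring_scope.

(* The name edist is shadowed by a distance of MathComp-Analysis. *)
Local Notation dist := Defs.edist.

Set Implicit Arguments.
Unset Strict Implicit.

Section EuclideanPlane.
Variable R : realType.
Implicit Types (A B F X Y Z : R * R).

Definition midpoint A B : R * R := ((A.1 + B.1) / 2, (A.2 + B.2) / 2).

(** Twice the signed area of the triangle [A B F]; as a function of [F], an affine form vanishing on
    the line [AB] when [A] and [B] differ. *)
Definition cross A B F : R :=
  (A.1 - F.1) * (B.2 - F.2) - (A.2 - F.2) * (B.1 - F.1).

(** The convexity defect, at the midpoint of [AB], of the distance to [F]. *)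
Definition gap A B F : R :=
  dist A F + dist B F - 2 * dist (midpoint A B) F.

(** * Inequalities for the Euclidean distance *)

Lemma edist_ge0 X Y : 0 <= dist X Y.
Proof. exact: sqrtr_ge0. Qed.

Lemma sqr_edist X Y : dist X Y ^+ 2 = (X.1 - Y.1) ^+ 2 + (X.2 - Y.2) ^+ 2.
Proof. by rewrite sqr_sqrtr// addr_ge0// sqr_ge0. Qed.

Lemma edistC X Y : dist X Y = dist Y X.
Proof. by rewrite /dist -sqrrN opprB -[(X.2 - _) ^+ 2]sqrrN opprB. Qed.

Lemma edist_le X Y (r : R) : 0 <= r ->
  (X.1 - Y.1) ^+ 2 + (X.2 - Y.2) ^+ 2 <= r ^+ 2 -> dist X Y <= r.
Proof.
by move=> r0 h; rewrite -(ler_pXn2r (ltn0Sn 1)) ?nnegrE ?edist_ge0// sqr_edist.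
Qed.

Lemma ler_edist_fst X Y : `|X.1 - Y.1| <= dist X Y.
Proof. by rewrite -sqrtr_sqr ler_wsqrtr// lerDl sqr_ge0. Qed.

Lemma ler_edist_snd X Y : `|X.2 - Y.2| <= dist X Y.
Proof. by rewrite -sqrtr_sqr ler_wsqrtr// lerDr sqr_ge0. Qed.

Lemma edist_le_sum X Y : dist X Y <= `|X.1 - Y.1| + `|X.2 - Y.2|.
Proof.
apply: edist_le; first by rewrite addr_ge0.
rewrite -[(X.1 - _) ^+ 2]real_normK ?num_real//.
rewrite -[(X.2 - _) ^+ 2]real_normK ?num_real//.
by have := mulr_ge0 (normr_ge0 (X.1 - Y.1)) (normr_ge0 (X.2 - Y.2)); nra.
Qed.

Lemma edist_triangle X Y Z : dist X Z <= dist X Y + dist Y Z.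
Proof.
apply: edist_le; first by rewrite addr_ge0 ?edist_ge0.
have CS : (X.1 - Y.1) * (Y.1 - Z.1) + (X.2 - Y.2) * (Y.2 - Z.2) <=
    dist X Y * dist Y Z.
  apply: le_trans (ler_norm _) _.
  rewrite -(ler_pXn2r (ltn0Sn 1)) ?nnegrE ?mulr_ge0 ?edist_ge0//.
  rewrite exprMn !sqr_edist real_normK ?num_real// -subr_ge0.
  set x := X.1 - Y.1; set y := X.2 - Y.2; set z := Y.1 - Z.1; set t := Y.2 - Z.2.
  rewrite [X in 0 <= X](_ : _ = (x * t - y * z) ^+ 2) ?sqr_ge0//; ring.
have -> : X.1 - Z.1 = (X.1 - Y.1) + (Y.1 - Z.1) by ring.
have -> : X.2 - Z.2 = (X.2 - Y.2) + (Y.2 - Z.2) by ring.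
rewrite sqrrD [leRHS]sqrrD !sqr_edist; lra.
Qed.

Lemma edist_lipschitz X Y F : `|dist X F - dist Y F| <= dist X Y.
Proof.
rewrite ler_norml; have := edist_triangle X Y F.
by have := edist_triangle Y X F; rewrite (edistC Y X); lra.
Qed.

(** * The convexity defect on one edge *)

Section Gap.
Variables A B F : R * R.
Let a := dist A F.
Let b := dist B F.
Let m := dist (midpoint A B) F.
Let h2 := ((A.1 - B.1) ^+ 2 + (A.2 - B.2) ^+ 2) / 4.

Let parallelogram : a ^+ 2 + b ^+ 2 = 2 * (m ^+ 2 + h2).
Proof. by rewrite /a /b /m !sqr_edist /h2 /=; field. Qed.

(** Lagrange's identity: [m ^+ 2 - h2] is the inner product of [A - F] and [B - F]. *)
Let sqr_cross : (a * b) ^+ 2 - (m ^+ 2 - h2) ^+ 2 = cross A B F ^+ 2.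
Proof. by rewrite exprMn /a /b /m !sqr_edist /h2 /cross /=; field. Qed.

Let ab_ge : `|m ^+ 2 - h2| <= a * b.
Proof.
rewrite -(ler_pXn2r (ltn0Sn 1)) ?nnegrE ?mulr_ge0 ?edist_ge0//.
by rewrite real_normK ?num_real// -subr_ge0 sqr_cross sqr_ge0.
Qed.

Lemma gap_ge0 : 0 <= gap A B F.
Proof.
rewrite /gap subr_ge0 -/a -/b -/m -(ler_pXn2r (ltn0Sn 1)) ?nnegrE; last 2 first.
- by rewrite mulr_ge0 ?edist_ge0.
- by rewrite addr_ge0 ?edist_ge0.
by have := parallelogram; move: ab_ge; rewrite ler_norml => /andP[_]; nra.
Qed.

(** Strict convexity made quantitative. With [s] the inner product of [A - F] and [B - F], both the
    gap and the squared cross product contain the factor [a * b - s]; the cofactors are at most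
    [4 * r] and [r ^+ 2]. *)
Lemma cross_le_gap (r : R) : a <= r -> b <= r -> m <= r ->
  cross A B F ^+ 2 <= 4 * r ^+ 3 * gap A B F.
Proof.
move=> ar br mr.
have [a0 b0 m0] : [/\ 0 <= a, 0 <= b & 0 <= m] by split; exact: edist_ge0.
have g0 : 0 <= gap A B F := gap_ge0.
have gapE : gap A B F * (a + b + 2 * m) = 2 * (a * b - (m ^+ 2 - h2)).
  transitivity (a ^+ 2 + b ^+ 2 + 2 * (a * b) - 4 * m ^+ 2).
    by rewrite /gap -/a -/b -/m; ring.
  by rewrite parallelogram; ring.
have crossE : cross A B F ^+ 2 =
    (a * b - (m ^+ 2 - h2)) * (a * b + (m ^+ 2 - h2)).
  by rewrite -sqr_cross; ring.
have [q0 q1] := andP (etrans (esym (ler_norml _ _)) ab_ge).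
have -> : cross A B F ^+ 2 =
    gap A B F * ((a + b + 2 * m) * ((a * b + (m ^+ 2 - h2)) / 2)).
  by rewrite mulrA gapE crossE; field.
rewrite mulrC ler_wpM2r//.
have -> : 4 * r ^+ 3 = (4 * r) * r ^+ 2 by ring.
apply: ler_pM; [lra|lra|lra|].
(* By the parallelogram law [a * b <= m ^+ 2 + h2], so the last factor is at most [m ^+ 2]. *)
have : m ^+ 2 <= r ^+ 2 by rewrite ler_pXn2r// nnegrE; lra.
have := sqr_ge0 (a - b); have := parallelogram; nra.
Qed.

End Gap.

(** * Linear approximation of the distance to one focus *)

(* Subtracting the linearization at 0; the junk value 0 / 0 = 0 makes the
   statement hold also when F = 0. *)
Lemma focal_lipschitz X Y F (r : R) : 0 < r ->
  dist X 0 <= r -> dist Y 0 <= r ->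
  `|dist X F - dist Y F
    + ((X.1 - Y.1) * (F.1 / dist F 0) + (X.2 - Y.2) * (F.2 / dist F 0))|
  <= 10 * r / (dist F 0 + r) * dist X Y.
Proof.
move=> r0 Xr Yr.
set a := dist X F; set b := dist Y F; set l := dist F 0; set d := dist X Y.
set u := F.1 / l; set v := F.2 / l; set E := a - b + _.
have l0 : 0 <= l := edist_ge0 _ _.
have F1l : `|F.1| <= l by have := ler_edist_fst F 0; rewrite subr0.
have F2l : `|F.2| <= l by have := ler_edist_snd F 0; rewrite subr0.
have unit_coord (x : R) : `|x| <= l -> `|x / l| <= 1 /\ x / l * l = x.
  move=> xl; have [l00|ln0] := eqVneq l 0.
    move: xl; rewrite l00 invr0 !mulr0 normr0 normr_le0 => /eqP->.
    by rewrite ler01.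
  rewrite divfK// normf_div (ger0_norm l0) ler_pdivrMr ?mul1r//.
  by rewrite lt_def ln0.
have [u1 ul] := unit_coord _ F1l; have [v1 vl] := unit_coord _ F2l.
rewrite -/u -/v in u1 ul v1 vl.
have [a0 b0 d0] : [/\ 0 <= a, 0 <= b & 0 <= d] by split; exact: edist_ge0.
have X1 : `|X.1 - Y.1| <= d := ler_edist_fst _ _.
have X2 : `|X.2 - Y.2| <= d := ler_edist_snd _ _.
have al : `|a - l| <= r.
  by apply: le_trans Xr; rewrite /l (edistC F) edist_lipschitz.
have bl : `|b - l| <= r.
  by apply: le_trans Yr; rewrite /l (edistC F) edist_lipschitz.
have coord_le (x y w : R) : `|x| <= r -> `|y| <= r -> `|w| <= 1 ->
    `|x + y + w * (a + b - 2 * l)| <= 4 * r.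
  move=> xr yr w1; apply: le_trans (ler_normD _ _) _.
  have : `|w * (a + b - 2 * l)| <= 2 * r.
    rewrite normrM -[leRHS]mul1r ler_pM//.
    have -> : a + b - 2 * l = (a - l) + (b - l) by ring.
    by apply: le_trans (ler_normD _ _) _; lra.
  by have := ler_normD x y; lra.
have coord r' Z : dist Z 0 <= r' -> `|Z.1| <= r' /\ `|Z.2| <= r'.
  move=> h; have := ler_edist_fst Z 0; have := ler_edist_snd Z 0.
  by rewrite !subr0; lra.
have [Xr1 Xr2] := coord _ _ Xr; have [Yr1 Yr2] := coord _ _ Yr.
(* Multiplying by [a + b] turns [a - b] into a difference of squares, in which the terms linear in
   [F] cancel up to [a + b - 2 * l]. This bound serves distant focuses, [E3] near ones. *)
have Eab : `|E| * (a + b) <= 8 * r * d.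
  have ab0 : 0 <= a + b by rewrite addr_ge0.
  rewrite -(ger0_norm ab0) -normrM.
  have -> : E * (a + b) = (X.1 - Y.1) * (X.1 + Y.1 + u * (a + b - 2 * l))
                        + (X.2 - Y.2) * (X.2 + Y.2 + v * (a + b - 2 * l)).
    have -> : E * (a + b) = a ^+ 2 - b ^+ 2 +
        ((X.1 - Y.1) * u + (X.2 - Y.2) * v) * (a + b) by rewrite /E; ring.
    rewrite !mulrBr !(mulrCA _ 2) ul vl /a /b !sqr_edist; ring.
  apply: le_trans (ler_normD _ _) _; rewrite !normrM.
  have -> : 8 * r * d = d * (4 * r) + d * (4 * r) by ring.
  by rewrite lerD// ler_pM// coord_le.
have E3 : `|E| <= 3 * d.
  have ad : `|a - b| <= d := edist_lipschitz _ _ _.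
  have : `|(X.1 - Y.1) * u| <= d * 1 by rewrite normrM ler_pM.
  have : `|(X.2 - Y.2) * v| <= d * 1 by rewrite normrM ler_pM.
  have := ler_normD (a - b) ((X.1 - Y.1) * u + (X.2 - Y.2) * v).
  have := ler_normD ((X.1 - Y.1) * u) ((X.2 - Y.2) * v).
  by rewrite -/E; lra.
(* From [2 * l <= a + b + 2 * r] one gets [l * |E| <= (4 + 3) * r * d]; adding
   [r * |E| <= 3 * r * d] gives the constant 10. *)
rewrite mulrAC ler_pdivlMr; last by lra.
move: al bl; rewrite !ler_norml => /andP[al _] /andP[bl _].
have := ler_wpM2r (ltW r0) E3.
have : `|E| * (2 * l) <= `|E| * (a + b + 2 * r) by rewrite ler_wpM2l//; lra.
lra.
Qed.

(** * Lower bound for the defects over three edges *)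

(* A point lying nearly on the lines V0V1 and V1V2 is near V1, and one lying
   nearly on V1V2 and V2V3 is near V2. *)
Lemma lines_not_concurrent V0 V1 V2 V3 (r : R) :
  cross V0 V1 V2 != 0 -> cross V1 V2 V3 != 0 ->
  dist V0 0 <= r -> dist V1 0 <= r -> dist V2 0 <= r -> dist V3 0 <= r ->
  exists2 k : R, 0 < k & forall F, k * (dist F 0 + r) <=
    `|cross V0 V1 F| + `|cross V1 V2 F| + `|cross V2 V3 F|.
Proof.
move=> T0 T1 r0 r1 r2 r3.
set t := Num.min `|cross V0 V1 V2| `|cross V1 V2 V3|.
have t0 : 0 < t by rewrite lt_min !normr_gt0 T0.
set d := dist V1 V2.
have d0 : 0 < d.
  rewrite lt_def edist_ge0 andbT; apply: contra T0 => /eqP d0.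
  have := ler_edist_fst V1 V2; have := ler_edist_snd V1 V2.
  rewrite -/d d0 !normr_le0 !subr_eq0 => /eqP h2 /eqP h1.
  by rewrite /cross h1 h2; apply/eqP; ring.
have rge0 : 0 <= r by apply: le_trans r0; exact: edist_ge0.
have K0 : 0 < 16 * r ^+ 2 / d + 4 * r.
  have : d <= 2 * r.
    by have := edist_triangle V1 0 V2; rewrite (edistC 0) -/d; lra.
  move=> dr; rewrite ltr_wpDl//; last lra.
  by rewrite divr_ge0 ?mulr_ge0 ?sqr_ge0// ltW.
have dd (X Y : R * R) : dist X 0 <= r -> dist Y 0 <= r ->
   `|X.1 - Y.1| <= 2 * r /\ `|X.2 - Y.2| <= 2 * r.
  move=> Xr Yr; have := edist_triangle X 0 Y; rewrite (edistC 0).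
  by have := ler_edist_fst X Y; have := ler_edist_snd X Y; lra.
have solve (A B x y s : R) : `|A| <= 2 * r -> `|B| <= 2 * r ->
    `|x| + `|y| <= s -> `|x * A - y * B| <= 2 * r * s.
  move=> Ar Br xys; apply: (@le_trans _ _ (2 * r * (`|x| + `|y|))); last first.
    by rewrite ler_wpM2l// mulr_ge0.
  apply: le_trans (ler_normB _ _) _; rewrite !normrM mulrDr.
  by rewrite lerD// mulrC ler_wpM2r.
exists (t / (16 * r ^+ 2 / d + 4 * r)); first by rewrite divr_gt0.
move=> F; rewrite mulrAC ler_pdivrMr//.
set c0 := cross V0 V1 F; set c1 := cross V1 V2 F; set c2 := cross V2 V3 F.
set s := _ + _ + _.
have s0 : 0 <= s by rewrite !addr_ge0.
have s01 : `|c0| + `|c1| <= s by rewrite lerDl.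
have s12 : `|c1| + `|c2| <= s by rewrite /s -addrA lerDr.
have tle (T x y : R) : t <= `|T| -> T * x = y -> t * `|x| <= `|y|.
  by move=> tT <-; rewrite normrM ler_wpM2r.
have tT0 : t <= `|cross V0 V1 V2| by rewrite ge_min lexx.
have tT1 : t <= `|cross V1 V2 V3| by rewrite ge_min lexx orbT.
have [a1 a2] := dd _ _ r2 r1; have [b1 b2] := dd _ _ r1 r0.
have [e1 e2] := dd _ _ r3 r2.
(* Cramer's rule: the forms [c0] and [c1] both vanish at [V1], and recover [F - V1] with determinant
   [cross V0 V1 V2]. Likewise [c1] and [c2] at [V2]. *)
have h11 : t * `|F.1 - V1.1| <= 2 * r * s.
  apply: le_trans (tle _ _ (c0 * (V2.1 - V1.1) - c1 * (V1.1 - V0.1)) tT0 _) _.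
    by rewrite /c0 /c1 /cross; ring.
  exact: solve.
have h12 : t * `|F.2 - V1.2| <= 2 * r * s.
  apply: le_trans (tle _ _ (c0 * (V2.2 - V1.2) - c1 * (V1.2 - V0.2)) tT0 _) _.
    by rewrite /c0 /c1 /cross; ring.
  exact: solve.
have h21 : t * `|F.1 - V2.1| <= 2 * r * s.
  apply: le_trans (tle _ _ (c1 * (V3.1 - V2.1) - c2 * (V2.1 - V1.1)) tT1 _) _.
    by rewrite /c1 /c2 /cross; ring.
  exact: solve.
have h22 : t * `|F.2 - V2.2| <= 2 * r * s.
  apply: le_trans (tle _ _ (c1 * (V3.2 - V2.2) - c2 * (V2.2 - V1.2)) tT1 _) _.
    by rewrite /c1 /c2 /cross; ring.
  exact: solve.
have near1 : t * dist F V1 <= 4 * r * s.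
  have := ler_wpM2l (ltW t0) (edist_le_sum F V1); rewrite mulrDr; lra.
have near2 : t * dist F V2 <= 4 * r * s.
  have := ler_wpM2l (ltW t0) (edist_le_sum F V2); rewrite mulrDr; lra.
have td : t * d <= 8 * r * s.
  have := ler_wpM2l (ltW t0) (edist_triangle V1 F V2).
  by rewrite (edistC V1 F) -/d mulrDr; lra.
have tl : t * dist F 0 <= t * r + 4 * r * s.
  have : t * dist V1 0 <= t * r by rewrite ler_pM2l.
  by have := ler_wpM2l (ltW t0) (edist_triangle F V1 0); rewrite mulrDr; lra.
(* As [F] cannot be near both [V1] and [V2], [s] is bounded below; this absorbs the term [2 * t * r]
   left by [tl]. *)
have : t * (2 * r) <= 16 * r ^+ 2 / d * s.
  rewrite mulrAC ler_pdivlMr//; have := ler_wpM2l rge0 td; lra.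
set y := 16 * r ^+ 2 / d; lra.
Qed.

Lemma gap_sum_ge V0 V1 V2 V3 (r : R) :
  cross V0 V1 V2 != 0 -> cross V1 V2 V3 != 0 ->
  dist V0 0 <= r -> dist V1 0 <= r -> dist V2 0 <= r -> dist V3 0 <= r ->
  0 < r -> exists2 k : R, 0 < k & forall F,
    k / (dist F 0 + r) <= gap V0 V1 F + gap V1 V2 F + gap V2 V3 F.
Proof.
move=> T0 T1 r0 r1 r2 r3 rgt0.
have [k k0 kF] := lines_not_concurrent T0 T1 r0 r1 r2 r3.
(* The 12 is 3 from Cauchy-Schwarz on three terms times 4 from [cross_le_gap], applied with radius
   [q]. *)
exists (k ^+ 2 / 12) => [|F]; first by rewrite divr_gt0 ?exprn_gt0.
set q := dist F 0 + r; set g := _ + _ + _.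
have q0 : 0 < q by rewrite ltr_wpDl ?edist_ge0.
have vertex X : dist X 0 <= r -> dist X F <= q.
  by move=> Xr; have := edist_triangle X 0 F; rewrite (edistC 0 F) /q; lra.
have edge A B : dist A 0 <= r -> dist B 0 <= r ->
    cross A B F ^+ 2 <= 4 * q ^+ 3 * gap A B F.
  move=> /vertex Aq /vertex Bq; apply: cross_le_gap => //.
  by have := gap_ge0 A B F; rewrite /gap; lra.
have := edge _ _ r0 r1; have := edge _ _ r1 r2; have := edge _ _ r2 r3.
have : (k * q) ^+ 2 <=
    3 * (cross V0 V1 F ^+ 2 + cross V1 V2 F ^+ 2 + cross V2 V3 F ^+ 2).
  rewrite -(real_normK (num_real (cross V0 V1 F))).
  rewrite -(real_normK (num_real (cross V1 V2 F))).
  rewrite -(real_normK (num_real (cross V2 V3 F))).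
  have := kF F; rewrite -/q.
  set x := `|cross V0 V1 F|; set y := `|cross V1 V2 F|.
  set z := `|cross V2 V3 F| => kq.
  have : (k * q) ^+ 2 <= (x + y + z) ^+ 2.
    by rewrite ler_pXn2r// nnegrE ?(ltW (mulr_gt0 k0 q0))// !addr_ge0//
      normr_ge0.
  have := sqr_ge0 (x - y); have := sqr_ge0 (y - z); have := sqr_ge0 (x - z).
  lra.
move=> hk h3 h2 h1.
have : k ^+ 2 * q ^+ 2 <= 12 * q * g * q ^+ 2 by rewrite /g; lra.
rewrite ler_pM2r ?exprn_gt0// => kg.
rewrite ler_pdivrMr// ler_pdivrMr//; lra.
Qed.

(** * Level sets of sums of distances *)

Lemma sum_edist_lipschitz m (F : 'I_m -> R * R) X Y (r : R) : 0 < r ->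
  dist X 0 <= r -> dist Y 0 <= r ->
  `|\sum_(i < m) dist X (F i) - \sum_(i < m) dist Y (F i)
    + ((X.1 - Y.1) * (\sum_(i < m) (F i).1 / dist (F i) 0)
       + (X.2 - Y.2) * (\sum_(i < m) (F i).2 / dist (F i) 0))|
  <= 10 * r * (\sum_(i < m) (dist (F i) 0 + r)^-1) * dist X Y.
Proof.
move=> r0 Xr Yr; rewrite !mulr_sumr mulr_suml -sumrB -!big_split/=.
by apply: le_trans (ler_norm_sum _ _ _) _; apply: ler_sum => i _;
  exact: focal_lipschitz.
Qed.

Lemma midpoint_segment A B : segment A B (midpoint A B).
Proof.
exists (1 / 2); first by rewrite /= in_itv/=; lra.
by rewrite /midpoint; congr pair; field.
Qed.

Lemma segment_left A B : segment A B A.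
Proof.
by exists 0; rewrite ?subr0 ?mul0r ?mul1r ?addr0 -?surjective_pairing//=
  in_itv/= lexx ler01.
Qed.

Lemma segment_right A B : segment A B B.
Proof.
by exists 1; rewrite ?subrr ?mul0r ?mul1r ?add0r -?surjective_pairing//=
  in_itv/= lexx ler01.
Qed.

(** [e] is chosen from the vertices alone, before the focuses; this uniformity lets their number
    grow along a sequence. *)
Lemma level_set_far V0 V1 V2 V3 :
  cross V0 V1 V2 != 0 -> cross V1 V2 V3 != 0 ->
  exists2 e : R, 0 < e & forall m (F : 'I_m -> R * R) (c : R), (0 < m)%N ->
    ~ (forall Q, (segment V0 V1 `|` segment V1 V2 `|` segment V2 V3) Q ->
         exists2 X, \sum_(i < m) dist X (F i) = c & dist X Q < e).
Proof.
move=> T0 T1.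
(* The extra 1 keeps points within [e <= 1] of the edge points considered inside the ball of radius
   [r]. *)
pose r := dist V0 0 + dist V1 0 + dist V2 0 + dist V3 0 + 1.
have [n0 n1 n2 n3] :
    [/\ 0 <= dist V0 0, 0 <= dist V1 0, 0 <= dist V2 0 & 0 <= dist V3 0].
  by split; exact: edist_ge0.
have [r0 r1 r2 r3] : [/\ dist V0 0 <= r - 1, dist V1 0 <= r - 1,
    dist V2 0 <= r - 1 & dist V3 0 <= r - 1] by split; rewrite /r; lra.
have rgt0 : 0 < r by rewrite /r; lra.
have inr Q : dist Q 0 <= r - 1 -> dist Q 0 <= r by lra.
have [k k0 kF] := gap_sum_ge T0 T1 (inr _ r0) (inr _ r1) (inr _ r2) (inr _ r3)
  rgt0.
pose t := `|cross V0 V1 V2|; have t0 : 0 < t by rewrite normr_gt0.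
(* Obtained by inserting the bounds [kS] on [S] and [vN] on the linear part into the definition of
   [N], so that [N <= e * C * N]. *)
pose C := (12 / k) * (10 * r + 160 * r ^+ 3 / t) + 16 * r / t.
have C0 : 0 <= C.
  by rewrite /C addr_ge0 ?mulr_ge0 ?addr_ge0 ?mulr_ge0 ?exprn_ge0 ?invr_ge0//
     ltW.
have C1 : 0 < 1 + C by lra.
pose e := (1 + C)^-1.
have e0 : 0 < e by rewrite invr_gt0.
have e1 : e <= 1 by rewrite invf_le1//; lra.
have eC : e * C < 1 by rewrite mulrC ltr_pdivrMr//; lra.
exists e => // m F c m0 near.
pose f X := \sum_(i < m) dist X (F i).
pose S := \sum_(i < m) (dist (F i) 0 + r)^-1.
pose v1 := \sum_(i < m) (F i).1 / dist (F i) 0.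
pose v2 := \sum_(i < m) (F i).2 / dist (F i) 0.
pose N := 10 * r * S + `|v1| + `|v2|.
have S0 : 0 < S.
  rewrite /S (bigD1 (Ordinal m0))//= ltr_pwDl ?invr_gt0//.
    by rewrite ltr_wpDl ?edist_ge0.
  by apply: sumr_ge0 => i _; rewrite invr_ge0 addr_ge0 ?edist_ge0// ltW.
have rS0 : 0 < 10 * r * S by rewrite !mulr_gt0.
have N0 : 0 < N by rewrite /N -addrA ltr_pwDl// addr_ge0.
have lip X Y : dist X 0 <= r -> dist Y 0 <= r ->
    `|f X - f Y + ((X.1 - Y.1) * v1 + (X.2 - Y.2) * v2)| <=
      10 * r * S * dist X Y by exact: sum_edist_lipschitz.
have lipN X Y : dist X 0 <= r -> dist Y 0 <= r ->
    `|f X - f Y| <= N * dist X Y.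
  move=> Xr Yr; have := lip _ _ Xr Yr.
  set p := _ * v1 + _ => h.
  have hp : `|p| <= dist X Y * `|v1| + dist X Y * `|v2|.
    rewrite (le_trans (ler_normD _ _))// !normrM.
    by rewrite lerD// ler_wpM2r// ?ler_edist_fst ?ler_edist_snd.
  have -> : f X - f Y = (f X - f Y + p) - p by ring.
  apply: le_trans (ler_normB _ _) _; rewrite /N; lra.
have close Q : dist Q 0 <= r - 1 ->
    (segment V0 V1 `|` segment V1 V2 `|` segment V2 V3) Q ->
    `|f Q - c| <= e * N.
  move=> Qr /near[X <- XQ]; have Xr : dist X 0 <= r.
    by have := edist_triangle X Q 0; lra.
  apply: le_trans (lipN _ _ (inr _ Qr) Xr) _.
  by rewrite mulrC ler_wpM2r ?ltW// edistC.
(* The gap has coefficients 1, 1, -2: the level [c] cancels and the errors add up to four times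
   [e * N]. *)
have close_gap A B : dist A 0 <= r - 1 -> dist B 0 <= r - 1 ->
    segment A B `<=` segment V0 V1 `|` segment V1 V2 `|` segment V2 V3 ->
    \sum_(i < m) gap A B (F i) <= 4 * (e * N).
  move=> Ar Br sub.
  have Mr : dist (midpoint A B) 0 <= r - 1.
    by have := gap_ge0 A B 0; rewrite /gap; lra.
  have := close _ Ar (sub _ (@segment_left A B)).
  have := close _ Br (sub _ (@segment_right A B)).
  have := close _ Mr (sub _ (@midpoint_segment A B)).
  rewrite !ler_norml /gap sumrB big_split/= -mulr_sumr -/(f A) -/(f B).
  rewrite -/(f (midpoint A B)); lra.
have kS : k * S <= 12 * (e * N).
  have : k * S <= \sum_(i < m) gap V0 V1 (F i) + \sum_(i < m) gap V1 V2 (F i)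
                + \sum_(i < m) gap V2 V3 (F i).
    by rewrite mulr_sumr -!big_split/=; apply: ler_sum => i _; exact: kF.
  have := close_gap _ _ r0 r1 (fun _ h => or_introl (or_introl h)).
  have := close_gap _ _ r1 r2 (fun _ h => or_introl (or_intror h)).
  have := close_gap _ _ r2 r3 (fun _ h => or_intror h).
  lra.
have in0 : (segment V0 V1 `|` segment V1 V2 `|` segment V2 V3) V0.
  by do 2 left; exact: segment_left.
have slope V : dist V 0 <= r - 1 ->
    (segment V0 V1 `|` segment V1 V2 `|` segment V2 V3) V ->
    `|(V.1 - V0.1) * v1 + (V.2 - V0.2) * v2| <= 2 * (e * N) + 20 * r ^+ 2 * S.
  move=> Vr inV; have := lip _ _ (inr _ Vr) (inr _ r0).
  have := close _ Vr inV; have := close _ r0 in0.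
  set p := _ * v1 + _.
  have : 10 * r * S * dist V V0 <= 10 * r * S * (2 * r).
    rewrite ler_pM2l//; have := edist_triangle V 0 V0.
    by rewrite (edistC 0); lra.
  rewrite !ler_norml; lra.
have dd (X Y : R * R) : dist X 0 <= r - 1 -> dist Y 0 <= r - 1 ->
   `|X.1 - Y.1| <= 2 * r /\ `|X.2 - Y.2| <= 2 * r.
  move=> Xr Yr; have := edist_triangle X 0 Y; rewrite (edistC 0).
  by have := ler_edist_fst X Y; have := ler_edist_snd X Y; lra.
have in1 : (segment V0 V1 `|` segment V1 V2 `|` segment V2 V3) V1.
  by do 2 left; exact: segment_right.
have in2 : (segment V0 V1 `|` segment V1 V2 `|` segment V2 V3) V2.
  by left; right; exact: segment_right.
have := slope _ r1 in1; have := slope _ r2 in2.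
set p1 := (V1.1 - _) * v1 + _; set p2 := (V2.1 - _) * v1 + _.
set w := 2 * (e * N) + _ => p2w p1w.
have [a1 a2] := dd _ _ r1 r0; have [b1 b2] := dd _ _ r2 r0.
(* The slopes along [V1 - V0] and [V2 - V0] determine [(v1, v2)], since these directions are
   independent. *)
have cramer (x y A B : R) : cross V0 V1 V2 * x = p1 * A - p2 * B ->
    `|A| <= 2 * r -> `|B| <= 2 * r -> t * `|x| <= 4 * r * w.
  move=> xE Ar Br; rewrite -normrM xE.
  apply: le_trans (ler_normB _ _) _; rewrite !normrM.
  have -> : 4 * r * w = w * (2 * r) + w * (2 * r) by ring.
  by rewrite lerD// ler_pM.
have v1w : t * `|v1| <= 4 * r * w.
  by apply: (cramer v1 0 (V2.2 - V0.2) (V1.2 - V0.2)) => //;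
    rewrite /p1 /p2 /cross; ring.
have v2w : t * `|v2| <= 4 * r * w.
  by apply: (cramer v2 0 (- (V2.1 - V0.1)) (- (V1.1 - V0.1))); rewrite ?normrN//;
    rewrite /p1 /p2 /cross; ring.
have {}kS : S <= 12 / k * (e * N) by rewrite mulrAC ler_pdivlMr//; lra.
have vN : `|v1| + `|v2| <= 16 * r / t * (e * N) + 160 * r ^+ 3 / t * S.
  have -> : 16 * r / t * (e * N) + 160 * r ^+ 3 / t * S = 8 * r * w / t.
    by rewrite /w; field; rewrite gt_eqF.
  rewrite ler_pdivlMr//; lra.
have : N <= e * C * N.
  have q0 : 0 <= 10 * r + 160 * r ^+ 3 / t.
    by rewrite addr_ge0 ?mulr_ge0 ?exprn_ge0 ?invr_ge0// ltW.
  rewrite {1}/N /C; move: vN (ler_wpM2l q0 kS); clear.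
  move: (12 / k) (160 * r ^+ 3 / t) (16 * r / t) => x y z; lra.
by apply/negP; rewrite -ltNge gtr_pMl.
Qed.

(** * From Hausdorff distance to nearby points *)

(** The bound on [L] and a point of [K] make the supremum over [L] genuine rather than the default
    0. *)
Lemma hausdorff_dist_near (K L : set (R * R)) (e B : R) : K !=set0 ->
  (forall Y, L Y -> dist Y 0 <= B) -> hausdorff_dist K L < e ->
  forall Y, L Y -> exists2 X, K X & dist X Y < e.
Proof.
move=> [X0 KX0] LB hKL Y LY.
pose D Z := [set dist X Z | X in K].
have Dlb Z : has_inf (D Z).
  split; first by exists (dist X0 Z), X0.
  by exists 0 => _ [X _ <-]; exact: edist_ge0.
have sup_ub : has_sup [set inf (D Z) | Z in L].
  split; first by exists (inf (D Y)), Y.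
  exists (dist X0 0 + B) => _ [Z LZ <-].
  apply: le_trans (_ : dist X0 Z <= _).
    by apply: ge_inf; [exact: (Dlb Z).2 | exists X0].
  by have := edist_triangle X0 0 Z; rewrite (edistC 0); have := LB _ LZ; lra.
have : inf (D Y) < e.
  apply: le_lt_trans hKL; rewrite /hausdorff_dist le_max; apply/orP; right.
  by apply: sup_upper_bound => //; exists Y.
by move=> /(inf_lt (Dlb Y).1)[_ [X KX <-]]; exists X.
Qed.

Lemma segment_bounded A B Y (r : R) : dist A 0 <= r -> dist B 0 <= r ->
  segment A B Y -> dist Y 0 <= 2 * r.
Proof.
move=> Ar Br [s]; rewrite /= in_itv/= => /andP[s0 s1] <-.
apply: le_trans (edist_le_sum _ _) _; rewrite /= !subr0.
have conv (x y : R) : `|x| <= r -> `|y| <= r -> `|(1 - s) * x + s * y| <= r.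
  rewrite !ler_norml => /andP[? ?] /andP[? ?]; apply/andP; split; nra.
have [A1 A2] : `|A.1| <= r /\ `|A.2| <= r.
  by have := ler_edist_fst A 0; have := ler_edist_snd A 0; rewrite !subr0; lra.
have [B1 B2] : `|B.1| <= r /\ `|B.2| <= r.
  by have := ler_edist_fst B 0; have := ler_edist_snd B 0; rewrite !subr0; lra.
by have := conv _ _ A1 B1; have := conv _ _ A2 B2; lra.
Qed.

(** * Vertices of the regular polygon *)

Lemma regular_vertex_bounded p (O : R * R) (r a : R) k : 0 < r ->
  dist (regular_vertex p O r a k) 0 <= dist O 0 + r.
Proof.
move=> r0; apply: le_trans (edist_triangle _ O _) _; rewrite addrC lerD2l.
apply: edist_le; first exact: ltW.
rewrite /= !(addrC O.1) !(addrC O.2) !addrK !exprMn -mulrDr cos2Dsin2.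
by rewrite mulr1.
Qed.

(** Measuring angles from the middle vertex gives [2 * r ^+ 2 * sin b * (1 - cos b)], and [3 <= p]
    puts the central angle [b] strictly between 0 and [pi]. *)
Lemma cross_regular_vertex p (O : R * R) (r a : R) k : (3 <= p)%N -> 0 < r ->
  cross (regular_vertex p O r a k) (regular_vertex p O r a k.+1)
    (regular_vertex p O r a k.+2) != 0.
Proof.
move=> p3 r0; rewrite /cross /regular_vertex/=.
have p0 : 0 < p%:R :> R by rewrite ltr0n (leq_trans _ p3).
set b : R := 2 * pi / p%:R; set th : R := a + k.+1%:R * (2 * pi) / p%:R.
have -> : a + k%:R * (2 * pi) / p%:R = th - b.
  by rewrite /th /b -[k.+1%:R]natr1; field; rewrite gt_eqF.
have -> : a + k.+2%:R * (2 * pi) / p%:R = th + b.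
  by rewrite /th /b -[k.+2%:R]natr1; field; rewrite gt_eqF.
have b0 : 0 < b by rewrite divr_gt0 ?mulr_gt0 ?pi_gt0.
have bpi : b < pi.
  rewrite ltr_pdivrMr// mulrC ltr_pM2l ?pi_gt0//.
  by rewrite ltr_nat (leq_trans _ p3).
have sb : 0 < sin b by rewrite sin_gt0_pi// b0.
have cb : cos b < 1.
  have := cos2Dsin2 b; have := exprn_gt0 2 sb; nra.
rewrite cosB cosD sinB sinD.
set c := cos th; set s := sin th.
have cs : c ^+ 2 + s ^+ 2 = 1 := cos2Dsin2 th.
rewrite [X in X != 0](_ : _ =
  2 * r ^+ 2 * sin b * (1 - cos b) * (c ^+ 2 + s ^+ 2)); last by ring.
by rewrite cs mulr1 gt_eqF// !mulr_gt0// subr_gt0.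
Qed.

End EuclideanPlane.

Unset Implicit Arguments.

Theorem theorem3 (R : realType) (p : nat) (P : set (R * R)) :
  (3 <= p)%N -> regular_polygon p P ->
  ~ exists E : nat -> set (R * R),
      (forall n : nat, polyellipse (E n)) /\
      hausdorff_dist (E n) P @[n --> \oo] --> (0 : R).
Proof.
move=> p3 [ctr [r [a [r0 ->]]]] [E [Eell]].
(* The edges of index 0, 1, 2 are used; for [p = 3] the fourth vertex is the first one again, which
   [level_set_far] allows. *)
have [e e0 far_e] := level_set_far (cross_regular_vertex ctr a 0 p3 r0)
  (cross_regular_vertex ctr a 1 p3 r0).
move=> /cvgr0Pnorm_lt/(_ _ e0)/filter_ex[n] /(le_lt_trans (ler_norm _)).
have [m [F [c [m0 -> E0]]]] := Eell n.
move=> /(hausdorff_dist_near E0 (B := 2 * (dist ctr 0 + r))) near_P.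
apply: (far_e m F c m0) => Q VQ; apply: near_P.
- move=> Y [k _]; apply: segment_bounded; exact: regular_vertex_bounded.
- by case: VQ => [[]|] VQ; [exists 0%N|exists 1%N|exists 2%N];
    rewrite //= (leq_trans _ p3).
Qed.
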